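(* Let $q$ be a prime power and let $n$ be a positive integer. Let $L(X)=\sum_{i=m}^{n}a_iX^{q^i}$, where $a_i\in\mathbb{F}_q$, $a_m\neq 0$, $a_n\ne0$, and $1\le m\le n-1$. Then $q^m\cdot(q^m-1)\cdot(q^n-1)$ divides the order of the Galois group of $L(X)/X-t$ over $\mathbb{F}_q(t)$.
   Context: For a prime power $q$, $\mathbb{F}_q$ is the finite field with $q$ elements; $t$ is transcendental over $\mathbb{F}_q$ and $\mathbb{F}_q(t)$ is the field of rational functions. $L(X)/X=\sum_{i=m}^{n}a_iX^{q^i-1}$, and $L(X)/X-t$ is regarded as a polynomial in $X$ over $\mathbb{F}_q(t)$. The Galois group of a separable polynomial over a field is the Galois group of its splitting field over that field. *)

(* Defs.v *)
From mathcomp Require Import all_boot all_order all_fingroup all_algebra all_field.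

Set Implicit Arguments.
Unset Strict Implicit.
Unset Printing Implicit Defensive.

Import GRing.Theory.

Local Open Scope ring_scope.

Definition linearized (F : nzRingType) (q m n : nat) (a : nat -> F) : {poly F} :=
  \sum_(m <= i < n.+1) a i *: 'X^(q ^ i).

(* L(X)/X, written out as in sum_i a_i X^(q^i - 1) *)
Definition linearized_over_X (F : nzRingType) (q m n : nat) (a : nat -> F) :
    {poly F} :=
  \sum_(m <= i < n.+1) a i *: 'X^(q ^ i - 1).

Lemma linearized_over_XE (F : nzRingType) (q m n : nat) (a : nat -> F) :
  (0 < q)%N -> linearized_over_X q m n a * 'X = linearized q m n a.
Proof.
move=> q_gt0; rewrite /linearized /linearized_over_X mulr_suml.
by apply: eq_bigr => i _; rewrite -scalerAl -exprSr subn1 prednK ?expn_gt0 ?q_gt0.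
Qed.

(* F(t) is {fraction {poly F}}; t is the image of the indeterminate of F[t]. *)
Definition ratfun_t (F : fieldType) : {fraction {poly F}} := tofrac 'X.

Definition ratfun_const (F : fieldType) (c : F) : {fraction {poly F}} :=
  tofrac c%:P.

(* L(X)/X - t, a polynomial in X over F(t) *)
Definition linearized_over_X_sub_t (F : fieldType) (q m n : nat) (a : nat -> F) :
    {poly {fraction {poly F}}} :=
  map_poly (@ratfun_const F) (linearized_over_X q m n a) - (ratfun_t F)%:P.

(* E is a splitting field of f over K: f splits into linear factors over E,
   and E is generated over K by its roots.  For such an E the Galois group of f
   over K is 'Gal({:E} / 1), the subspace 1 being the image of K in E. *)
Definition is_splitting_field (K : fieldType) (f : {poly K})
    (E : splittingFieldType K) :=
  splittingFieldFor 1 (map_poly (in_alg E) f) {:E}.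

(* Main.v *)
Require Import Defs.
From HB Require Import structures.
From mathcomp Require Import all_boot all_order all_fingroup all_algebra all_solvable.
From mathcomp Require Import all_field.
From mathcomp Require Import boolp ring.

(** Write K = F_q(t) and f = L(X)/X - t.  Since #|Gal| = [E : K], the divisibility
is a statement about degrees; they are read off from how f factors over two
completions of K.

At t = infinity, with u = 1/t, the polynomial u f = u L(X)/X - 1 is a reversed
Eisenstein polynomial over F_q[[u]] (eisenstein_infinity).  Hence f is
irreducible over K, and a root z of f generates an extension of K of degree
q^n - 1 (irreducible_linearized_over_X_sub_t).

At t = 0, L(X)/X = X^(q^m - 1) N(X)^(q^m) where N(0) = a_m <> 0 and N is
separable and non-constant, because all coefficients are fixed by Frobenius
(linearized_over_X_frobenius).  Let k be an extension of F_q containing a root b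
of N.  Over k[[t]], Hensel's lemma lifts the coprime factorizations of L(X)/X
given by X^(q^m - 1) and by (X - b)^(q^m) to factors A and B of f.  The constant
terms of A and of B(X + b) divide t, so A and B are Eisenstein and
therefore irreducible of degrees q^m - 1 and q^m over k((t)) (hensel_eisenstein,
local_factors).

To come back to K, embed E in an extension O of k((t)) generated by the image of a
primitive element of E.  For every subfield M of E and M' of O with M mapped into
M', [O : M'] divides [E : M] (dvdn_degree_base_change): over M', the minimal
polynomial over M of a primitive element x splits into irreducible factors that all
have degree [O : M'], since every conjugate of x generates E.  Now choose z so
that it maps to a root of B.  Then [O : k((t))] is divisible by q^m - 1 (because of
A) and is q^m [O : k((t))(z)], so q^m - 1, being prime to q^m, divides
[O : k((t))(z)] and hence [E : K(z)].  So (q^n - 1)(q^m - 1) divides [E : K], and so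
does q^m, which is prime to it (dvdn_splitting_degree). *)

Set Implicit Arguments.
Unset Strict Implicit.
Unset Printing Implicit Defensive.

Import GRing.Theory.
Local Open Scope ring_scope.

(** * Formal power series over a field *)

Definition fps (k : fieldType) := nat -> k.

Section FormalPowerSeries.

Variable k : fieldType.
Implicit Types f g h : fps k.

HB.instance Definition _ := gen_eqMixin (fps k).
HB.instance Definition _ := gen_choiceMixin (fps k).

Definition fps_add f g : fps k := fun n => f n + g n.
Definition fps_opp f : fps k := fun n => - f n.
Definition fps_const (c : k) : fps k := fun n => if n is 0 then c else 0.

Fact fps_addA : associative fps_add.
Proof. by move=> f g h; apply/funext => n; apply: addrA. Qed.
Fact fps_addC : commutative fps_add.
Proof. by move=> f g; apply/funext => n; apply: addrC. Qed.
Fact fps_add0 : left_id (fun=> 0 : k) fps_add.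
Proof. by move=> f; apply/funext => n; apply: add0r. Qed.
Fact fps_addN : left_inverse (fun=> 0 : k) fps_opp fps_add.
Proof. by move=> f; apply/funext => n; apply: addNr. Qed.

HB.instance Definition _ :=
  GRing.isZmodule.Build (fps k) fps_addA fps_addC fps_add0 fps_addN.

Lemma fpsDE f g n : (f + g) n = f n + g n. Proof. by []. Qed.

Definition fps_trunc n f : {poly k} := \poly_(i < n.+1) f i.

(** Going through truncations reduces the ring axioms to those of {poly k}. *)
Definition fps_mul f g : fps k := fun n => (fps_trunc n f * fps_trunc n g)`_n.

Lemma fps_mul_coef (p r : {poly k}) f g n :
  (forall i, (i <= n)%N -> p`_i = f i) -> (forall i, (i <= n)%N -> r`_i = g i) ->
  (p * r)`_n = fps_mul f g n.
Proof.
move=> pf rg; rewrite /fps_mul !coefM; apply: eq_bigr => i _.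
have le_in : (i <= n)%N by rewrite -ltnS.
by rewrite !coef_poly !ltnS le_in leq_subr pf ?rg ?leq_subr.
Qed.

Lemma coef_fps_trunc n f i : (i <= n)%N -> (fps_trunc n f)`_i = f i.
Proof. by move=> le_in; rewrite coef_poly ltnS le_in. Qed.

Lemma coef_fps_trunc_mul n f g i : (i <= n)%N ->
  (fps_trunc n f * fps_trunc n g)`_i = fps_mul f g i.
Proof.
move=> le_in; apply: fps_mul_coef => j le_ji;
  by rewrite coef_fps_trunc ?(leq_trans le_ji).
Qed.

Fact fps_mulA : associative fps_mul.
Proof.
move=> f g h; apply/funext => n.
rewrite -(@fps_mul_coef (fps_trunc n f) (fps_trunc n g * fps_trunc n h)); first last.
- exact: coef_fps_trunc_mul.
- exact: coef_fps_trunc.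
rewrite mulrA; apply: fps_mul_coef; first exact: coef_fps_trunc_mul.
exact: coef_fps_trunc.
Qed.
Fact fps_mulC : commutative fps_mul.
Proof. by move=> f g; apply/funext => n; rewrite /fps_mul mulrC. Qed.
Fact fps_mul1 : left_id (fps_const 1) fps_mul.
Proof.
move=> f; apply/funext => n; rewrite -(@fps_mul_coef 1 (fps_trunc n f)).
- by rewrite mul1r coef_fps_trunc.
- by case=> [|i] _; rewrite coef1.
- exact: coef_fps_trunc.
Qed.
Fact fps_mulD : left_distributive fps_mul fps_add.
Proof.
move=> f g h; apply/funext => n; rewrite /fps_add -[LHS](@fps_mul_coef
  (fps_trunc n f + fps_trunc n g) (fps_trunc n h)) ?mulrDl ?coefD //.
- by move=> i le_in; rewrite coefD !coef_fps_trunc.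
- exact: coef_fps_trunc.
Qed.
Fact fps_1neq0 : fps_const 1 != 0.
Proof. by apply/eqP => /(congr1 (@^~ 0)) /eqP; rewrite oner_eq0. Qed.

HB.instance Definition _ := GRing.Zmodule_isComNzRing.Build (fps k)
  fps_mulA fps_mulC fps_mul1 fps_mulD fps_1neq0.

Lemma fpsM f g n : (f * g) n = \sum_(i < n.+1) f i * g (n - i)%N.
Proof.
rewrite {1}/GRing.mul /= /fps_mul coefM; apply: eq_bigr => i _.
by rewrite !coef_fps_trunc ?leq_subr // -ltnS.
Qed.

Lemma fpsM0 f g : (f * g) 0 = f 0 * g 0.
Proof. by rewrite fpsM big_ord1. Qed.

(** Integral domains are built on unit rings; choosing inverses avoids computing
    them. *)
Definition fps_unit : {pred fps k} := fun f => `[< exists g, g * f = 1 >].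
Definition fps_inv f : fps k :=
  if pselect (exists g, g * f = 1) is left ex then sval (cid ex) else f.

Fact fps_mulV : {in fps_unit, left_inverse 1 fps_inv *%R}.
Proof.
move=> f /asboolP unit_f; rewrite /fps_inv; case: pselect => // ex.
by case: cid.
Qed.
Fact fps_unitP f g : g * f = 1 -> fps_unit f.
Proof. by move=> gf1; apply/asboolP; exists g. Qed.
Fact fps_inv_out : {in [predC fps_unit], fps_inv =1 id}.
Proof.
move=> f; rewrite inE => /asboolP unit'f; rewrite /fps_inv.
by case: pselect.
Qed.

HB.instance Definition _ := GRing.ComNzRing_hasMulInverse.Build (fps k)
  fps_mulV fps_unitP fps_inv_out.

Lemma fps_neq0 f : f != 0 -> exists2 n, f n != 0 & forall i, (i < n)%N -> f i = 0.
Proof.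
move=> nz_f; have ex_n : exists n, f n != 0.
  apply: contrapT => f0; case/eqP: nz_f; apply/funext => n.
  by apply/eqP/negP => nz_fn; apply: f0; exists n; apply/negP.
case: (ex_minnP ex_n) => n nz_fn min_n; exists n => // i lt_in.
by apply: contraTeq lt_in => /min_n; rewrite -leqNgt.
Qed.

Fact fps_mulf_eq0 : GRing.integral_domain_axiom (fps k).
Proof.
move=> f g fg0; apply: contraTT isT; rewrite negb_or => /andP[/fps_neq0[n nz_fn f0]].
case/fps_neq0=> m nz_gm g0; have /eqP := congr1 (@^~ (n + m)%N) fg0.
rewrite fpsM /= (bigD1 (inord n)) //= inordK ?ltnS ?leq_addr // addKn.
rewrite big1 ?addr0 ?mulf_eq0 ?(negPf nz_fn) ?(negPf nz_gm) // => i.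
rewrite -val_eqE /= inordK ?ltnS ?leq_addr // => ne_in.
have [lt_in|le_ni] := ltnP i n; first by rewrite f0 ?mul0r.
rewrite g0 ?mulr0 // ltn_subLR ?ltn_add2r; last by rewrite -ltnS.
by rewrite ltn_neqAle eq_sym ne_in.
Qed.

HB.instance Definition _ :=
  GRing.ComUnitRing_isIntegral.Build (fps k) fps_mulf_eq0.

Lemma fps_const_zmod : zmod_morphism fps_const.
Proof.
move=> c d; apply/funext => -[] //= n.
by rewrite /GRing.add /= /fps_add /= subrr.
Qed.
Lemma fps_const_monoid : monoid_morphism fps_const.
Proof.
split=> // c d; apply/funext => n; rewrite fpsM; case: n => [|n].
  by rewrite big_ord1.
rewrite big_ord_recl mulr0 big1 ?addr0 // => i _.
by rewrite mul0r.
Qed.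
HB.instance Definition _ :=
  GRing.isZmodMorphism.Build k (fps k) fps_const fps_const_zmod.
HB.instance Definition _ :=
  GRing.isMonoidMorphism.Build k (fps k) fps_const fps_const_monoid.

(** The coefficient of index 0 is the residue map modulo fps_var. *)
Definition fps_coef n f : k := f n.
Lemma fps_coef_zmod n : zmod_morphism (fps_coef n). Proof. by []. Qed.
HB.instance Definition _ n :=
  GRing.isZmodMorphism.Build (fps k) k (fps_coef n) (fps_coef_zmod n).
Lemma fps_coef0_monoid : monoid_morphism (fps_coef 0).
Proof. by split=> // f g; apply: fpsM0. Qed.
HB.instance Definition _ :=
  GRing.isMonoidMorphism.Build (fps k) k (fps_coef 0) fps_coef0_monoid.

Definition fps_var : fps k := fun n => (n == 1)%:R.

Lemma fps_varM f n : (fps_var * f) n = if n is n'.+1 then f n' else 0.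
Proof.
case: n => [|n]; first by rewrite fpsM0 mul0r.
rewrite fpsM 2!big_ord_recl big1 ?mul0r ?add0r ?addr0 ?mul1r ?subSS ?subn0 //.
by move=> i _; rewrite mul0r.
Qed.

Lemma fps_var_neq0 : fps_var != 0.
Proof. by apply/eqP => /(congr1 (@^~ 1%N)) /eqP; rewrite oner_eq0. Qed.

Lemma fps_divr_var f : f 0 = 0 -> f = fps_var * (fun n => f n.+1).
Proof. by move=> f00; apply/funext => -[|n]; rewrite fps_varM. Qed.

End FormalPowerSeries.

(** * Gauss's lemma and Eisenstein criteria at a uniformizer *)

Section Fractions.

Variable D : idomainType.

(** Elements of {fraction D} are classes of pairs; this turns a representative
    into a genuine quotient, so that the quotient construction is never opened
    again. *)
Lemma frac_repr (x : {fraction D}) :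
  x = tofrac \n_(generic_quotient.repr x) / tofrac \d_(generic_quotient.repr x).
Proof.
rewrite -[LHS]generic_quotient.reprK; case: (generic_quotient.repr x) => -[n d] /= nz_d.
apply: (@mulIf _ (tofrac d)); first by rewrite tofrac_eq0.
rewrite divfK ?tofrac_eq0 //; unlock tofrac; rewrite -[_ * _]FracField.pi_mul.
apply/generic_quotient.eqmodP => /=; rewrite FracField.equivfE /FracField.mulf /=.
by rewrite !numden_Ratio ?oner_neq0 //= ?mulr1 ?mul1r // mulrC.
Qed.

Lemma fracP (x : {fraction D}) :
  exists n d : D, d != 0 /\ x = tofrac n / tofrac d.
Proof.
exists (\n_(generic_quotient.repr x)), (\d_(generic_quotient.repr x)).
by split; [apply: denom_ratioP | apply: frac_repr].
Qed.

Lemma tofrac_inj : injective (@tofrac D).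
Proof. by move=> x y /eqP; rewrite tofrac_eq => /eqP. Qed.

Lemma map_tofrac_inj : injective (map_poly (@tofrac D)).
Proof. exact: (map_inj_poly tofrac_inj (rmorph0 _)). Qed.

Lemma size_map_tofrac (P : {poly D}) : size (map_poly (@tofrac D) P) = size P.
Proof. exact: (size_map_inj_poly tofrac_inj (rmorph0 _)). Qed.

Lemma clear_denominators (Q : {poly {fraction D}}) :
  exists (r : D) Q0, r != 0 /\ tofrac r *: Q = map_poly (@tofrac D) Q0.
Proof.
elim/poly_ind: Q => [|Q c [r [Q0 [nz_r DQ0]]]].
  by exists 1, 0; rewrite oner_neq0 scaler0 map_poly0.
have [n [d [nz_d ->]]] := fracP c.
exists (r * d), (d *: Q0 * 'X + (r * n)%:P); rewrite mulf_neq0 //; split=> //.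
rewrite [RHS]rmorphD [in RHS]rmorphM [RHS]/= map_polyX map_polyC map_polyZ.
rewrite -DQ0 scalerDr scalerA -!rmorphM [d * r]mulrC -scalerAl; congr (_ + _).
rewrite -mul_polyC -polyCM; congr _%:P => /=.
by rewrite !tofracM mulrACA mulfV ?tofrac_eq0 ?mulr1.
Qed.

End Fractions.

(** When res is a ring morphism, T generates its kernel and R localized at this
    kernel is a discrete valuation ring, in which x has valuation e. *)
Definition uniformizer (R : idomainType) (k : fieldType) (res : R -> k) (T : R) :=
  [/\ T != 0, res T = 0
    & forall x, x != 0 -> exists e x', x = T ^+ e * x' /\ res x' != 0].

Section Gauss.

Variables (R : idomainType) (k : fieldType) (res : {rmorphism R -> k}) (T : R).
Hypothesis unifT : uniformizer res T.
Implicit Types P Q S : {poly R}.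

Local Notation Kh := {fraction R}.
Local Notation "p ^F" := (map_poly (@tofrac R) p) (at level 2, format "p ^F").
Local Notation "p ^res" := (map_poly res p) (at level 2, format "p ^res").

Lemma res_eq0 x : res x = 0 -> exists y, x = T * y.
Proof.
have [->|nz_x] := eqVneq x 0; first by exists 0; rewrite mulr0.
case: unifT => _ _ /(_ x nz_x) [[|e] [x' [-> nz_x']]].
  by rewrite mul1r => x'0; rewrite x'0 eqxx in nz_x'.
by move=> _; exists (T ^+ e * x'); rewrite exprS mulrA.
Qed.

Lemma res_poly_eq0 P : P^res = 0 -> exists P1, P = T *: P1.
Proof.
have /choice[g Dg] x : exists y, res x = 0 -> x = T * y.
  have [/res_eq0[y ->]|nz_x] := eqVneq (res x) 0; first by exists y.
  by exists 0 => x0; rewrite x0 eqxx in nz_x.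
move=> P0; exists (\poly_(i < size P) g P`_i); apply/polyP => i.
rewrite coefZ coef_poly; case: ltnP => [_|le_Pi]; last by rewrite mulr0 nth_default.
by apply: Dg; rewrite -coef_map P0 coef0.
Qed.

Lemma primitive_part P : P != 0 ->
  exists e P', P = T ^+ e *: P' /\ P'^res != 0.
Proof.
case: unifT => nz_T _ fT.
rewrite -lead_coef_eq0 => /fT[e [x' [DP nz_x']]].
have {DP nz_x'}: exists i x', P`_i = T ^+ e * x' /\ res x' != 0.
  by exists (size P).-1, x'.
elim: e P => [|e IHe] P [i [x [DPi nz_x]]].
  exists 0%N, P; rewrite expr0 scale1r; split=> //.
  by apply: contraNneq nz_x => P0; rewrite -(mul1r x) -DPi -coef_map P0 coef0.
have [/res_poly_eq0[P1 DP]|nz_P0] := eqVneq P^res 0; last first.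
  by exists 0%N, P; rewrite expr0 scale1r.
have [|e' [P' [DP1 nz_P']]] := IHe P1; last first.
  by exists e'.+1, P'; rewrite exprS -scalerA -DP1.
exists i, x; split=> //; apply: (mulfI nz_T).
by rewrite mulrA -exprS -DPi DP coefZ.
Qed.

Lemma primitive_multiple (Q : {poly Kh}) : Q != 0 ->
  exists u Q', [/\ u != 0, u *: Q = Q'^F & Q'^res != 0].
Proof.
have [r [Q0 [nz_r DQ0]]] := clear_denominators Q => nz_Q.
have nz_Q0 : Q0 != 0.
  rewrite -size_poly_eq0 -size_map_tofrac -DQ0 size_poly_eq0.
  by rewrite scaler_eq0 tofrac_eq0 negb_or nz_r.
have [e [Q' [DQ' nz_Q']]] := primitive_part nz_Q0.
have nz_Te : tofrac (T ^+ e) != 0.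
  by case: unifT => nz_T _ _; rewrite tofrac_eq0 expf_neq0.
exists (tofrac r / tofrac (T ^+ e)), Q'; split=> //.
  by rewrite mulf_neq0 ?invr_eq0 // tofrac_eq0.
by rewrite mulrC -scalerA DQ0 DQ' map_polyZ scalerA mulVf ?scale1r.
Qed.

(** If P and Q are nonzero modulo T, then T^a P and T^b Q have valuations a and b,
    so equality forces a = b. *)
Lemma primitive_part_uniq a b P Q : P^res != 0 -> Q^res != 0 ->
  T ^+ a *: P = T ^+ b *: Q -> P = Q.
Proof.
case: unifT => nz_T T0 _.
wlog le_ab : a b P Q / (a <= b)%N => [IH|] nz_P nz_Q.
  have [le_ab|/ltnW le_ba] := leqP a b; first exact: IH.
  by move/esym/IH => ->.
rewrite -(subnKC le_ab) exprD -scalerA -!(mul_polyC (T ^+ a)).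
move/mulfI => DP; move: nz_P; rewrite {}DP; last by rewrite polyC_eq0 expf_neq0.
rewrite map_polyZ; case: (b - a)%N => [|e]; first by rewrite expr0 scale1r.
by rewrite exprS rmorphM /= T0 mul0r scale0r eqxx.
Qed.

(** Scale Q and S by constants so that they become integral and nonzero modulo T.
    Their product is then nonzero modulo T because k is a domain, so no power of T
    separates it from P; only a constant c prime to T is left. *)
Lemma gauss P (Q S : {poly Kh}) : P^res != 0 -> P^F = Q * S ->
  exists c Q' S',
    [/\ res c != 0, c *: P = Q' * S', size Q' = size Q & size S' = size S].
Proof.
move=> nz_P0 DP; have nz_P : P != 0.
  by apply: contraNneq nz_P0 => ->; rewrite map_poly0.
have: Q * S != 0 by rewrite -DP -size_poly_eq0 size_map_tofrac size_poly_eq0.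
rewrite mulf_eq0 negb_or => /andP[nz_Q nz_S].
have [u [Q1 [nz_u DQ1 nz_Q1]]] := primitive_multiple nz_Q.
have [v [S1 [nz_v DS1 nz_S1]]] := primitive_multiple nz_S.
have [x [y [nz_y Dxy]]] := fracP (u * v).
have nz_x : x != 0.
  apply: contraTneq (mulf_neq0 nz_u nz_v) => x0.
  by rewrite Dxy x0 rmorph0 mul0r eqxx.
have DxP : x *: P = y *: (Q1 * S1).
  apply: map_tofrac_inj; rewrite !map_polyZ rmorphM /= -DQ1 -DS1 DP.
  rewrite -scalerAl -scalerAr !scalerA -mulrA Dxy.
  by rewrite [_ * (_ / _)]mulrC divfK ?tofrac_eq0.
case: unifT => nz_T _ fT.
have [a [x' [Dx nz_x']]] := fT x nz_x.
have [b [y' [Dy nz_y']]] := fT y nz_y.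
exists x', (y' *: Q1), S1; split=> //.
- rewrite -scalerAl; apply: (@primitive_part_uniq a b).
  + by rewrite map_polyZ scaler_eq0 negb_or nz_x'.
  + by rewrite map_polyZ scaler_eq0 negb_or nz_y' rmorphM mulf_neq0.
  + by rewrite !scalerA -Dx -Dy.
- rewrite size_scale; last by apply: contraNneq nz_y' => ->; rewrite rmorph0.
  by rewrite -size_map_tofrac -DQ1 size_scale.
- by rewrite -size_map_tofrac -DS1 size_scale.
Qed.

(** Irreducibility over the field of fractions is thus a question about integral
    factorizations, up to a constant of nonzero residue. *)
Lemma irreducible_by_gauss P : P^res != 0 -> (1 < size P)%N ->
  (forall c Q S, res c != 0 -> c *: P = Q * S ->
     (1 < size Q)%N -> (1 < size S)%N -> False) ->
  irreducible_poly P^F.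
Proof.
move=> nz_P0 P_gt1 noQS; split=> [|Q Q_neq1 /dvdpP[S DP]].
  by rewrite size_map_tofrac.
have nz_P : P^F != 0 by rewrite -size_poly_gt0 size_map_tofrac ltnW.
move: (nz_P); rewrite DP mulf_eq0 negb_or => /andP[nz_S nz_Q].
have [c [S' [Q' [nz_c DcP sz_S sz_Q]]]] := gauss nz_P0 DP.
rewrite -dvdp_size_eqp ?dvdp_mull // size_mul //.
have [S_gt1|] := ltnP 1 (size S); last first.
  move: nz_S; rewrite -size_poly_gt0 => S_gt0 S_le1.
  by have /eqP-> : size S == 1%N; rewrite ?add1n // eqn_leq S_le1.
case: (noQS c S' Q'); rewrite ?sz_S ?sz_Q //.
by move: nz_Q Q_neq1; rewrite -size_poly_gt0; case: (size Q) => [|[]].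
Qed.

(** Modulo T, both factors of a factorization become constant multiples of powers
    of X - b, with no loss of degree.  If both are non-constant, both vanish at b
    modulo T, and T^2 divides P(b). *)
Lemma eisenstein P d (b : R) : (0 < d)%N -> size P = d.+1 ->
  P^res %= ('X - (res b)%:P) ^+ d -> (forall y, P.[b] != T ^+ 2 * y) ->
  irreducible_poly P^F.
Proof.
move=> d_gt0 szP Pd Pb.
have nz_P0 : P^res != 0.
  by rewrite -size_poly_gt0 (eqp_size Pd) size_exp_XsubC.
apply: irreducible_by_gauss; rewrite ?szP // => c Q S nz_c DP Q_gt1 S_gt1.
have nz_QS : Q^res * S^res != 0.
  by rewrite -rmorphM -DP /= map_polyZ scaler_eq0 negb_or nz_c.
have [nz_Q nz_S] : Q^res != 0 /\ S^res != 0.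
  by move: nz_QS; rewrite mulf_eq0 negb_or => /andP.
have szQS : (size Q^res + size S^res = size Q + size S)%N.
  have nz_c' : c != 0 by apply: contraNneq nz_c => ->; rewrite rmorph0.
  have: size (Q * S) = d.+1 by rewrite -DP size_scale.
  have: size (Q^res * S^res) = d.+1.
    by rewrite -rmorphM -DP /= map_polyZ size_scale // (eqp_size Pd) size_exp_XsubC.
  rewrite !size_mul ?size_poly_gt0 // -?size_poly_gt0 ?(ltnW Q_gt1) ?(ltnW S_gt1) //.
  move: (size _ + _)%N (size _ + _)%N => u v; case: u v => [|u] [|v] //= -> -> //.
have [szQ szS] : size Q^res = size Q /\ size S^res = size S.
  have leQ : (size Q^res <= size Q)%N by apply: size_poly.
  have leS : (size S^res <= size S)%N by apply: size_poly.
  split; apply/eqP; rewrite eqn_leq ?leQ ?leS /=.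
    by rewrite -(leq_add2r (size S^res)) szQS leq_add2l.
  by rewrite -(leq_add2l (size Q^res)) szQS leq_add2r.
have rootb U : U^res %| ('X - (res b)%:P) ^+ d -> (1 < size U^res)%N ->
    exists y, U.[b] = T * y.
  case/dvdp_exp_XsubCP=> i _ DU; rewrite (eqp_size DU) size_exp_XsubC ltnS => i_gt0.
  apply: res_eq0; apply/eqP; rewrite -horner_map -rootE (eqp_root DU).
  by rewrite -(prednK i_gt0) root_exp_XsubC.
have dvd_d U V : c *: P = U * V -> U^res %| ('X - (res b)%:P) ^+ d.
  move=> DUV; rewrite -(eqp_dvdr _ Pd) -(dvdpZr _ _ nz_c) -map_polyZ DUV rmorphM /=.
  exact: dvdp_mulr.
have [|y Dy] := rootb Q (dvd_d _ _ DP); first by rewrite szQ.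
have [||z Dz] := rootb S; first by apply: (dvd_d _ Q); rewrite mulrC.
  by rewrite szS.
have [x Dx] : exists x, P.[b] = T * x.
  apply: res_eq0; apply/eqP; rewrite -horner_map -rootE (eqp_root Pd).
  by rewrite -(prednK d_gt0) root_exp_XsubC.
have nz_T : T != 0 by case: unifT.
have [x' Dx'] : exists x', x = T * x'.
  apply: res_eq0; apply: (mulfI nz_c); rewrite mulr0 -rmorphM.
  have -> : c * x = T * (y * z).
    apply: (mulfI nz_T); rewrite mulrCA -Dx -hornerZ DP hornerM Dy Dz.
    by rewrite mulrACA -mulrA.
  by case: unifT => _ T0 _; rewrite rmorphM /= T0 mul0r.
by case/eqP: (Pb x'); rewrite Dx Dx' mulrA.
Qed.

(** The criterion for the reciprocal polynomial, stated without reversing: if P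
    is a nonzero constant modulo T, so are the factors of any factorization; if both
    are non-constant, T divides both leading coefficients and T^2 that of P. *)
Lemma eisenstein_infinity P : size P^res = 1%N -> (1 < size P)%N ->
  (forall y, lead_coef P != T ^+ 2 * y) -> irreducible_poly P^F.
Proof.
move=> szP0 P_gt1 Pl.
have nz_P0 : P^res != 0 by rewrite -size_poly_gt0 szP0.
apply: irreducible_by_gauss => // c Q S nz_c DP Q_gt1 S_gt1.
have szQS : size (Q^res * S^res) = 1%N.
  by rewrite -rmorphM -DP /= map_polyZ size_scale.
have leadT U V : size (U^res * V^res) = 1%N -> (1 < size U)%N ->
    exists y, lead_coef U = T * y.
  move=> UV1 U_gt1; apply: res_eq0; rewrite lead_coefE -coef_map nth_default //.
  move: UV1 => /eqP; rewrite size_mul_eq1 => /andP[/eqP-> _].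
  by rewrite -ltnS prednK // ltnW.
have [y Dy] := leadT Q S szQS Q_gt1.
have [|z Dz] := leadT S Q _ S_gt1; first by rewrite mulrC.
have nz_T : T != 0 by case: unifT.
have T0 : res T = 0 by case: unifT.
have := congr1 lead_coef DP; rewrite lead_coefM lead_coefZ Dy Dz => Dc.
have [x Dx] : exists x, lead_coef P = T * x.
  by apply: res_eq0; apply: (mulfI nz_c); rewrite mulr0 -rmorphM Dc !rmorphM /= T0 !mul0r.
have [x' Dx'] : exists x', x = T * x'.
  apply: res_eq0; apply: (mulfI nz_c); rewrite mulr0 -rmorphM.
  have -> : c * x = T * (y * z).
    by apply: (mulfI nz_T); rewrite mulrCA -Dx Dc mulrACA -mulrA.
  by rewrite rmorphM /= T0 mul0r.
by case/eqP: (Pl x'); rewrite Dx Dx' mulrA.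
Qed.

End Gauss.

(** * Hensel's lemma over formal power series *)

Section Hensel.

Variable k : fieldType.
Implicit Types (P G H : {poly fps k}) (g h c : {poly k}).

Lemma fps_uniformizer : uniformizer (@fps_coef k 0) (fps_var k).
Proof.
split=> [||f /fps_neq0[n]]; rewrite ?fps_var_neq0 //.
elim: n f => [|n IHn] f nz_fn f0.
  by exists 0%N, f; rewrite mul1r.
have [||e [f' [Df nz_f']]] := IHn (fun i => f i.+1) => // [i lt_in|].
  exact: f0.
by exists e.+1, f'; rewrite exprS -mulrA -Df -fps_divr_var ?f0.
Qed.

(** A polynomial over k[[T]] is a sequence of polynomials over k: level n P collects
    the coefficients of T^n. *)
Definition level n P : {poly k} := map_poly (@fps_coef k n) P.

Lemma coef_level n P i : (level n P)`_i = P`_i n.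
Proof. by rewrite coef_map. Qed.

Lemma level_ext P G : (forall n, level n P = level n G) -> P = G.
Proof.
move=> eqPG; apply/polyP => i; apply/funext => n.
by rewrite -!coef_level eqPG.
Qed.

Lemma levelM n P G :
  level n (P * G) = \sum_(i < n.+1) level i P * level (n - i) G.
Proof.
apply/polyP => j; rewrite coef_level coefM -/(fps_coef n _) raddf_sum coef_sum /=.
under eq_bigr => i _ do rewrite /fps_coef fpsM.
rewrite exchange_big /=; apply: eq_bigr => i _.
by rewrite coefM; apply: eq_bigr => l _; rewrite !coef_level.
Qed.

(** The bound s keeps the degree in X finite although there are infinitely many
    levels. *)
Definition poly_of_levels (s : nat) (g : nat -> {poly k}) : {poly fps k} :=
  \poly_(i < s) ((fun n => (g n)`_i) : fps k).

Lemma level_poly_of_levels s (g : nat -> {poly k}) n : (size (g n) <= s)%N ->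
  level n (poly_of_levels s g) = g n.
Proof.
move=> le_gs; apply/polyP => i; rewrite coef_level coef_poly.
by case: ltnP => // le_si; rewrite nth_default // (leq_trans le_gs).
Qed.

(** Reducing the coefficient of h modulo g bounds one degree; the equation itself
    then bounds the other one. *)
Lemma bezout_bounded g h c : coprimep g h -> g != 0 -> h != 0 ->
    (size c <= (size g + size h).-1)%N ->
  exists u v, [/\ g * v + u * h = c, (size u < size g)%N & (size v <= size h)%N].
Proof.
case/Bezout_eq1_coprimepP=> -[u0 v0] /= bez nz_g nz_h szc.
pose u := (v0 * c) %% g; pose v := u0 * c + (v0 * c) %/ g * h.
have Dc : g * v + u * h = c.
  transitivity ((u0 * g + v0 * h) * c); last by rewrite bez mul1r.
  have Dv0c : v0 * c = (v0 * c) %/ g * g + u := divp_eq _ _.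
  rewrite mulrDl [v0 * h * c]mulrAC Dv0c /v; ring.
have szu : (size u < size g)%N by rewrite ltn_modp.
exists u, v; split=> //.
have [->|nz_v] := eqVneq v 0; first by rewrite size_poly0.
have: (size (g * v)%R <= (size g + size h).-1)%N.
  rewrite -[(g * v)%R](addrK (u * h)) Dc (leq_trans (size_polyD _ _)) // geq_max szc.
  rewrite size_polyN (leq_trans (size_polyMleq _ _)) //.
  by rewrite -!subn1 leq_sub2r // leq_add2r ltnW.
rewrite size_mul // -(prednK (_ : (0 < size g)%N)) ?size_poly_gt0 //.
by rewrite !addSn /= leq_add2l.
Qed.

(** The factors are built level by level.  The level n + 1 of P = G H reads
    g H_(n+1) + G_(n+1) h = c, where c depends on lower levels only, and the Bezout
    identity for g and h solves it.  The hypothesis on size P, which says that the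
    leading coefficient of P is a unit, keeps all degrees bounded; G_(n+1) has degree
    smaller than g, so G is monic. *)
Lemma hensel P g h : g \is monic -> coprimep g h -> h != 0 ->
    level 0 P = g * h -> (size P <= size (g * h)%R)%N ->
  exists G H, [/\ P = G * H, level 0 G = g, level 0 H = h & size G = size g].
Proof.
move=> mon_g co_gh nz_h DP0 szP; have nz_g := monic_neq0 mon_g.
have solve c : exists uv, (size c <= (size g + size h).-1)%N ->
    [/\ g * uv.2 + uv.1 * h = c, (size uv.1 < size g)%N & (size uv.2 <= size h)%N].
  have [le_c|] := leqP (size c) (size g + size h).-1; last by exists (0, 0).
  by have [u [v]] := bezout_bounded co_gh nz_g nz_h le_c; exists (u, v).
have /choice[bez bezP] := solve.
pose step n (s : nat -> {poly k} * {poly k}) :=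
  bez (level n.+1 P - \sum_(i < n) (s i.+1).1 * (s (n - i)%N).2).
pose fix approx n : nat -> {poly k} * {poly k} :=
  if n is n'.+1 then
    fun i => if (i <= n')%N then approx n' i else step n' (approx n')
  else fun=> (g, h).
pose s n := approx n n.
have approxE n i : (i <= n)%N -> approx n i = s i.
  elim: n => [|n IHn]; first by rewrite leqn0 => /eqP->.
  rewrite leq_eqVlt => /predU1P[-> //|]; rewrite ltnS /= => le_in.
  by rewrite le_in IHn.
pose c n := level n.+1 P - \sum_(i < n) (s i.+1).1 * (s (n - i)%N).2.
have sS n : s n.+1 = bez (c n).
  rewrite {1}/s /= ltnn /step; congr (bez (_ - _)); apply: eq_bigr => i _.
  by rewrite !approxE ?leq_subr.
pose small i := (size (s i).1 <= size g)%N && (size (s i).2 <= size h)%N.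
have szc n : (forall i, (i <= n)%N -> small i) ->
    (size (c n) <= (size g + size h).-1)%N.
  move=> small_s; rewrite (leq_trans (size_polyD _ _)) // geq_max size_polyN.
  apply/andP; split.
    exact: leq_trans (size_poly _ _) (leq_trans szP (size_polyMleq _ _)).
  rewrite (leq_trans (size_sum _ _ _)) //; apply/bigmax_leqP => i _.
  rewrite (leq_trans (size_polyMleq _ _)) // -!subn1 leq_sub2r // leq_add //.
    by case/andP: (small_s i.+1 (ltn_ord i)).
  by case/andP: (small_s (n - i)%N (leq_subr _ _)).
have szs n : small n.
  elim/ltn_ind: n => -[|n] IHn; first by rewrite /small /s /= !leqnn.
  have [|_ lt_g le_h] := bezP (c n).
    by apply: szc => i le_in; rewrite IHn ?ltnS.
  by rewrite /small sS (ltnW lt_g) le_h.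
have s_eq n : level n.+1 P = g * (s n.+1).2 + (s n.+1).1 * h
                 + \sum_(i < n) (s i.+1).1 * (s (n - i)%N).2.
  by have [|Dc _ _] := bezP (c n); [apply: szc | rewrite sS Dc subrK].
pose G := poly_of_levels (size g) (fun n => (s n).1).
pose H := poly_of_levels (size h) (fun n => (s n).2).
have levG n : level n G = (s n).1.
  by rewrite level_poly_of_levels //; have /andP[] := szs n.
have levH n : level n H = (s n).2.
  by rewrite level_poly_of_levels //; have /andP[] := szs n.
exists G, H; split; rewrite ?levG ?levH //.
  apply: level_ext => n; rewrite levelM.
  case: n => [|n]; first by rewrite big_ord1 levG levH.
  rewrite big_ord_recl big_ord_recr /= subnn subn0 !levG !levH s_eq -addrA.
  congr (_ + _); rewrite addrC; congr (_ + _); apply: eq_bigr => i _.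
  by rewrite levG levH /bump /= add1n subSS.
apply: size_poly_eq; apply/eqP => /(congr1 (fun f : fps k => f 0)) /eqP /=.
by rewrite -lead_coefE (monicP mon_g) oner_eq0.
Qed.

(** Hensel's lemma lifts (X - b)^d to a factor of F - T.  Its value at b divides
    F(b) - T = - T, so it cannot be divisible by T^2 and the factor is Eisenstein. *)
Lemma hensel_eisenstein (F h : {poly k}) b d : (0 < d)%N -> h.[b] != 0 ->
    F = ('X - b%:P) ^+ d * h ->
  exists P, [/\ size P = d.+1,
    map_poly (@tofrac (fps k)) P
      %| map_poly (@tofrac (fps k)) (map_poly (@fps_const k) F - (fps_var k)%:P)
    & irreducible_poly (map_poly (@tofrac (fps k)) P)].
Proof.
move=> d_gt0 nz_hb DF; set P0 := _ - _.
have nz_h : h != 0 by apply: contraNneq nz_hb => ->; rewrite horner0.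
have mon_g : ('X - b%:P) ^+ d \is monic by rewrite monic_exp ?monicXsubC.
have szF : (1 < size F)%N.
  rewrite DF size_monicM // size_exp_XsubC addSn -[2%N]/(1 + 1)%N.
  by rewrite leq_add // size_poly_gt0.
have szP0 : (size P0 <= size F)%N.
  rewrite (leq_trans (size_polyD _ _)) // geq_max size_polyN size_poly.
  by rewrite (leq_trans (size_polyC_leq1 _)) // ltnW.
have levP0 : level 0 P0 = F.
  apply/polyP => i; rewrite coef_level coefB coef_map coefC.
  by case: (i == 0)%N; rewrite /GRing.add /= /fps_add /GRing.opp /= /fps_opp oppr0 addr0.
have [|||B [H [DP0 levB _ szB]]] := hensel (P := P0) mon_g _ nz_h.
- by rewrite coprimep_expl // coprimep_sym coprimep_XsubC.
- by rewrite levP0.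
- by rewrite -DF.
exists B; rewrite DP0 rmorphM dvdp_mulIl szB size_exp_XsubC; split=> //.
apply: (eisenstein (b := fps_const b) fps_uniformizer d_gt0).
- by rewrite szB size_exp_XsubC.
- by rewrite -/(level 0 B) levB eqpxx.
move=> y; apply/eqP => DBb.
have : P0.[fps_const b] = - fps_var k.
  rewrite !hornerE horner_map DF hornerM horner_exp hornerXsubC subrr.
  by rewrite expr0n -[d == 0]negbK -lt0n d_gt0 mul0r rmorph0 sub0r.
rewrite DP0 hornerM DBb -mulrA expr2 -mulrA -[RHS]mulrN1.
move/(mulfI (fps_var_neq0 k))/(congr1 (fun f : fps k => f 0%N))/eqP.
by rewrite fps_varM eq_sym oppr_eq0 oner_eq0.
Qed.

End Hensel.

(** * Embeddings of fields of fractions *)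

Section FracLift.

Variables (D : idomainType) (K : fieldType) (f : {rmorphism D -> K}).
Hypothesis inj_f : injective f.

Definition frac_lift_fun (x : {fraction D}) : K :=
  f (\n_(generic_quotient.repr x)) / f (\d_(generic_quotient.repr x)).

(** Injectivity is an argument because the morphism structures below, which are
    inferred from the term frac_lift inj_f, depend on it. *)
Definition frac_lift (_ : injective f) := frac_lift_fun.

Lemma frac_liftE (n d : D) : d != 0 -> frac_lift inj_f (tofrac n / tofrac d) = f n / f d.
Proof.
move=> nz_d; rewrite /frac_lift /frac_lift_fun;
set x : {fraction D} := tofrac n / tofrac d; have := frac_repr x.
set n' := \n_ _; set d' := \d_ _; have nz_d' : d' != 0 := denom_ratioP _.
have nz_f y : y != 0 -> f y != 0 by rewrite -(inj_eq inj_f) rmorph0.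
rewrite /x => /eqP; rewrite !eqr_div ?tofrac_eq0 // -!tofracM tofrac_eq => /eqP eq_nd.
by apply/eqP; rewrite eqr_div ?nz_f // -!rmorphM eq_nd.
Qed.

Lemma frac_lift_zmod : zmod_morphism (frac_lift inj_f).
Proof.
move=> x y; have [n [d [nz_d ->]]] := fracP x; have [m [e [nz_e ->]]] := fracP y.
have nz_f z : z != 0 -> f z != 0 by rewrite -(inj_eq inj_f) rmorph0.
have -> : tofrac n / tofrac d - tofrac m / tofrac e
    = tofrac (n * e - m * d) / tofrac (d * e).
  by rewrite -mulNr addf_div ?tofrac_eq0 // tofracB !tofracM mulNr.
rewrite !frac_liftE ?mulf_neq0 // -[in RHS]mulNr addf_div ?nz_f //.
by rewrite rmorphB !rmorphM mulNr.
Qed.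

Lemma frac_lift_monoid : monoid_morphism (frac_lift inj_f).
Proof.
split=> [|x y].
  by rewrite -[1]divr1 -!(rmorph1 (@tofrac D)) frac_liftE ?oner_neq0 // rmorph1 divr1.
have [n [d [nz_d ->]]] := fracP x; have [m [e [nz_e ->]]] := fracP y.
rewrite mulf_div -!rmorphM !frac_liftE ?mulf_neq0 // !rmorphM /=.
by rewrite mulf_div.
Qed.

HB.instance Definition _ :=
  GRing.isZmodMorphism.Build _ _ (frac_lift inj_f) frac_lift_zmod.
HB.instance Definition _ :=
  GRing.isMonoidMorphism.Build _ _ (frac_lift inj_f) frac_lift_monoid.

Lemma frac_lift_tofrac x : frac_lift inj_f (tofrac x) = f x.
Proof.
rewrite -[tofrac x]divr1 -(rmorph1 (@tofrac D)) frac_liftE ?oner_neq0 //.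
by rewrite rmorph1 divr1.
Qed.

End FracLift.

(** A transcendental element z of L gives an embedding of F(t) into L with t sent
    to z; it is used with z = T and with z = 1/T. *)
Lemma ratfun_lift (F L : fieldType) (f : {rmorphism F -> L}) (z : L) :
    ~ algebraicOver f z ->
  exists i : {rmorphism {fraction {poly F}} -> L},
    (forall c, i (ratfun_const c) = f c) /\ i (ratfun_t F) = z.
Proof.
move=> trans_z; pose g := horner_morph (fun c => mulrC z (f c)).
have inj_g : injective g.
  apply: raddf_inj => p /eqP pz0; apply: contrapT => /eqP nz_p.
  by apply: trans_z; exists p; rewrite // rootE.
exists (frac_lift inj_g); split=> [c|].
  by rewrite /= frac_lift_tofrac // /g /= horner_morphC.
by apply: etrans (frac_lift_tofrac inj_g _) _; rewrite /g /= horner_morphX.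
Qed.

(** * Degrees of extensions and base change *)

Lemma irreducible_factor (K : fieldType) (p : {poly K}) : (1 < size p)%N ->
  exists2 r, irreducible_poly r & r %| p.
Proof.
have [n] := ubnP (size p); elim: n p => // n IHn p; rewrite ltnS => le_pn p_gt1.
have nz_p : p != 0 by rewrite -size_poly_gt0 ltnW.
have [irr_p|red_p] := pselect (irreducible_poly p); first by exists p.
have [q [q_neq1 dv_qp neq_qp]] :
    exists q : {poly K}, [/\ size q != 1%N, q %| p & ~~ (q %= p)].
  apply: contrapT => no_q; apply: red_p; split=> // q q_neq1 dv_qp.
  by apply: contrapT => /negP neq_qp; apply: no_q; exists q.
have nz_q : q != 0 by apply: contraTneq dv_qp => ->; rewrite dvd0p.
have lt_qp : (size q < size p)%N.
  by rewrite ltn_neqAle dvdp_leq // dvdp_size_eqp // neq_qp.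
have [||r irr_r dv_rq] := IHn q; first exact: leq_trans lt_qp _.
  by move: nz_q q_neq1; rewrite -size_poly_gt0; case: (size q) => [|[]].
by exists r; last exact: dvdp_trans dv_rq dv_qp.
Qed.

Lemma root_extension (K : fieldType) (p : {poly K}) : (1 < size p)%N ->
  exists (L : fieldExtType K) (z : L),
    root (map_poly (in_alg L) p) z /\ <<1; z>>%VS = fullv.
Proof.
case/irreducible_factor=> r irr_r dv_rp.
have [L _ [z rz0 genL]] := irredp_FAdjoin irr_r.
by exists L, z; split=> //; apply: root_dvdp rz0; rewrite dvdp_map.
Qed.

(** An element of E is the value at x of a polynomial q over K, and is sent to the
    value of q at y; this does not depend on q because p divides every polynomial
    over K that vanishes at x. *)
Lemma extend_to_simple_extension (K L : fieldType) (E : fieldExtType K)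
    (i : {rmorphism K -> L}) (p : {poly K}) (x : E) (y : L) :
    map_poly (in_alg E) p = minPoly 1 x -> <<1; x>>%VS = {:E}%VS ->
    root (map_poly i p) y ->
  exists j : {rmorphism E -> L}, j x = y /\ forall c, j c%:A = i c.
Proof.
move=> Dp genE py0.
have /choice[P PE] (e : E) : exists q, e = (map_poly (in_alg E) q).[x].
  by apply/Fadjoin1_polyP; rewrite genE memvf.
have eval0 q : (map_poly (in_alg E) q).[x] = 0 -> (map_poly i q).[y] = 0.
  move=> qx0; apply/eqP; rewrite -rootE; apply: root_dvdp py0.
  rewrite dvdp_map -(dvdp_map (in_alg E)) Dp minPoly_dvdp ?rootE ?qx0 //.
  by apply/polyOver1P; exists q.
pose j e := (map_poly i (P e)).[y].
have jE q e : e = (map_poly (in_alg E) q).[x] -> j e = (map_poly i q).[y].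
  move=> De; apply/eqP; rewrite -subr_eq0 -hornerN -hornerD -rmorphB; apply/eqP.
  by apply: eval0; rewrite rmorphB /= hornerD hornerN -PE De subrr.
have j_zmod : zmod_morphism j.
  move=> e e'; rewrite (jE (P e - P e')); first by rewrite rmorphB /= hornerD hornerN.
  by rewrite rmorphB /= hornerD hornerN -!PE.
have j_monoid : monoid_morphism j.
  split=> [|e e'].
    by rewrite (jE 1) ?rmorph1 ?hornerC.
  by rewrite (jE (P e * P e')) ?rmorphM /= ?hornerM // -!PE.
pose jA := GRing.isZmodMorphism.Build _ _ j j_zmod.
pose jM := GRing.isMonoidMorphism.Build _ _ j j_monoid.
pose jR : {rmorphism E -> L} := HB.pack j jA jM.
exists jR; split=> [|c] /=.
  by rewrite (jE 'X) ?map_polyX ?hornerX.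
by rewrite (jE c%:P) ?map_polyC ?hornerC.
Qed.

(** All irreducible factors of p over M have degree d. *)
Lemma dvdn_degree_of_roots (K : fieldType) (L : fieldExtType K) (M : {subfield L})
    (p : {poly L}) (rs : seq L) (d : nat) :
    p \is a polyOver M -> p %= \prod_(z <- rs) ('X - z%:P) ->
    all (fun z => adjoin_degree M z == d) rs ->
  (d %| size rs)%N.
Proof.
have [n] := ubnP (size rs); elim: n p rs => // n IHn p rs le_rs Mp Dp.
case: rs le_rs Dp => [|z rs] le_rs Dp deg_rs //; set zrs := z :: rs in le_rs Dp deg_rs *.
pose h := minPoly M z.
have pz0 : root p z by rewrite (eqp_root Dp) root_prod_XsubC mem_head.
have dv_hp : h %| p by rewrite minPoly_dvdp.
have Mh : h \is a polyOver M := minPolyOver M z.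
have [m1 Dh] : {m | h %= \prod_(z <- mask m zrs) ('X - z%:P)}.
  by apply: dvdp_prod_XsubC; rewrite -(eqp_dvdr _ Dp).
have [m2 Dq] : {m | p %/ h %= \prod_(z <- mask m zrs) ('X - z%:P)}.
  apply: dvdp_prod_XsubC; rewrite -(eqp_dvdr _ Dp).
  by rewrite -{2}(divpK dv_hp) dvdp_mulr.
have szh : size (mask m1 zrs) = d.
  have := eqp_size Dh; rewrite size_prod_XsubC size_minPoly => -[<-].
  by case/andP: deg_rs => /eqP.
have sz : (size zrs = size (mask m1 zrs) + size (mask m2 zrs))%N.
  have := eqp_size Dp; rewrite -(divpK dv_hp) size_mul; first last.
  - by rewrite monic_neq0 ?monic_minPoly.
  - by rewrite -size_poly_gt0 (eqp_size Dq) size_prod_XsubC.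
  by rewrite (eqp_size Dh) (eqp_size Dq) !size_prod_XsubC addnS addSn addnC => -[].
have d_gt0 : (0 < d)%N by case/andP: deg_rs => /eqP<- _.
rewrite sz szh dvdn_addr //; apply: (IHn (p %/ h)) => //.
- by rewrite ltnS sz szh in le_rs; rewrite (leq_trans _ le_rs) // -add1n leq_add2r.
- by rewrite divp_polyOver.
- by apply/allP => y /mem_mask /(allP deg_rs).
Qed.

(** The roots of the minimal polynomial of x over M all generate E over M, so their
    images all generate L over M' and have degree [L : M'] over M'. *)
Lemma dvdn_degree_base_change (K K' : fieldType)
    (E : splittingFieldType K) (L : fieldExtType K') (j : {rmorphism E -> L})
    (M : {subfield E}) (M' : {subfield L}) (x : E) :
    {in M, forall c, j c \in M'} ->
    <<M; x>>%VS = {:E}%VS -> <<M'; j x>>%VS = {:L}%VS ->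
  (\dim_M' {:L} %| \dim_M {:E})%N.
Proof.
move=> jM genE genL.
have [rs _ Drs] := normalFieldP (normalFieldf M) x (memvf x).
have szrs : size rs = \dim_M {:E}.
  have := congr1 (fun p : {poly E} => size p) Drs.
  by rewrite size_prod_XsubC size_minPoly => -[<-]; rewrite adjoin_degreeE genE.
rewrite -szrs -(size_map j).
apply: (@dvdn_degree_of_roots _ _ M' (map_poly j (minPoly M x))).
- apply/polyOverP => i; rewrite coef_map /= jM //.
  exact: (polyOverP (minPolyOver M x)).
- rewrite Drs rmorph_prod big_map.
  under eq_bigr do rewrite rmorphB /= map_polyX map_polyC.
  exact: eqpxx.
apply/allP => _ /mapP[r rs_r ->].
have px_r0 : root (minPoly M x) r by rewrite Drs root_prod_XsubC.
have /(minPoly_irr (minPolyOver M r)) : minPoly M r %| minPoly M x.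
  by rewrite minPoly_dvdp ?minPolyOver.
have -> : minPoly M r %= 1 = false.
  by rewrite -size_poly_eq1 size_minPoly /adjoin_degree.
rewrite orbF => /eqp_size; rewrite !size_minPoly => /succn_inj deg_r.
have genEr : <<M; r>>%VS = {:E}%VS.
  by apply/eqP; rewrite eqEdim subvf -genE !dim_Fadjoin deg_r /=.
suffices genLr : <<M'; j r>>%VS = {:L}%VS by rewrite adjoin_degreeE genLr.
apply/eqP; rewrite eqEsubv subvf -genL; apply/FadjoinP; split; first exact: subv_adjoin.
have /Fadjoin_polyP[q Mq ->] : x \in <<M; r>>%VS by rewrite genEr memvf.
rewrite -horner_map; apply: mempx_Fadjoin; apply/polyOverP => i.
by rewrite coef_map /= jM // (polyOverP Mq).
Qed.

Lemma adjoin_degree_irreducible (K : fieldType) (L : fieldExtType K) (p : {poly K})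
    (x : L) : irreducible_poly p -> root (map_poly (in_alg L) p) x ->
  adjoin_degree 1 x = (size p).-1.
Proof.
move=> irr_p px0.
have /polyOver1P[h Dh] := minPolyOver 1 x.
have dv_hp : h %| p.
  rewrite -(dvdp_map (in_alg L)) -Dh minPoly_dvdp //.
  by apply/polyOver1P; exists p.
have szh : size h = (adjoin_degree 1 x).+1.
  by rewrite -size_minPoly Dh size_map_poly.
rewrite -(eqp_size (irr_p.2 h _ dv_hp)) szh //.
Qed.

(** * The polynomial L(X)/X over a finite field *)

Section Linearized.

Variables (F : finFieldType) (q : nat).
Hypothesis cardF : #|F| = q.
Implicit Types (a : nat -> F) (m n i : nat).

Lemma q_gt1 : (1 < q)%N. Proof. by rewrite -cardF finNzRing_gt1. Qed.
Lemma q_gt0 : (0 < q)%N. Proof. exact: ltnW q_gt1. Qed.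

Lemma size_linearized_over_X m n a : (m <= n)%N -> a n != 0 ->
  size (linearized_over_X q m n a) = (q ^ n)%N
    /\ lead_coef (linearized_over_X q m n a) = a n.
Proof.
move=> le_mn nz_an; rewrite /linearized_over_X big_nat_recr //=.
set s := \sum_(m <= i < n) _.
have sz1 : size (a n *: 'X^(q ^ n - 1)) = (q ^ n)%N.
  by rewrite size_scale // size_polyXn subn1 prednK // expn_gt0 q_gt0.
have szs : (size s < q ^ n)%N.
  apply: (@leq_ltn_trans (q ^ n - 1)%N); last first.
    by rewrite subn1 prednK // expn_gt0 q_gt0.
  rewrite /s big_nat_cond; apply: (leq_trans (size_sum _ _ _)).
  apply/bigmax_leqP_seq => i _ /andP[/andP[_ lt_in] _].
  rewrite (leq_trans (size_scale_leq _ _)) // size_polyXn subn1.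
  rewrite prednK ?expn_gt0 ?q_gt0 //.
  by rewrite -ltnS subn1 prednK ?expn_gt0 ?q_gt0 // ltn_exp2l // q_gt1.
rewrite addrC size_polyDl ?sz1 // lead_coefDl ?sz1 //.
by rewrite lead_coefZ lead_coefXn mulr1.
Qed.

(** A finite field is an elementary abelian group for addition. *)
Lemma card_pnat : exists2 p, p \in [pchar F] & p.-nat q.
Proof.
have [p _ pcharF] := finPcharP F; exists p; rewrite // -cardF -cardsT.
by have /abelem_pgroup := fin_ring_pchar_abelem pcharF.
Qed.

Lemma natr_card i : (0 < i)%N -> (q ^ i)%:R = 0 :> F.
Proof.
move=> i_gt0; have [p pcharF] := card_pnat.
case/p_natP=> e Dq; have e_gt0 : (0 < e)%N.
  by have := q_gt1; rewrite Dq; case: e {Dq}.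
by apply/eqP; rewrite -(dvdn_pcharf pcharF) Dq -expnM dvdn_exp // muln_gt0 e_gt0.
Qed.

Lemma pcharX_card m : [pchar {poly F}].-nat (q ^ m)%N.
Proof.
have [p pcharF pq] := card_pnat.
have pF : p \in [pchar {poly F}] by rewrite (rmorph_pchar (@polyC F)).
by rewrite (eq_pnat _ (pcharf_eq pF)) pnatX pq.
Qed.

Lemma expf_cardX m (c : F) : c ^+ (q ^ m) = c.
Proof. by elim: m => [|m IHm]; rewrite ?expr1 // expnSr exprM IHm -cardF expf_card. Qed.

(** Since c^(q^m) = c on F and raising to the power q^m is additive, the sum of the
    a_i X^(q^i) is the q^m-th power of the sum of the a_i X^(q^(i - m)). *)
Lemma linearized_over_X_frobenius m n a : (m <= n)%N ->
  linearized_over_X q m n a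
    = 'X^(q ^ m - 1) * linearized_over_X q 0 (n - m) (fun i => a (i + m)%N) ^+ (q ^ m).
Proof.
move=> le_mn; rewrite /linearized_over_X -{1}[m]add0n big_addn subSn //.
have -> (r : seq nat) (G : nat -> {poly F}) :
    (\sum_(i <- r) G i) ^+ (q ^ m) = \sum_(i <- r) G i ^+ (q ^ m).
  elim/big_rec2: _ => [|i u v _ <-]; first by rewrite expr0n expn_eq0 eqn0Ngt q_gt0.
  by rewrite exprDn_pchar ?pcharX_card.
rewrite mulr_sumr; apply: eq_bigr => i _.
rewrite exprZn expf_cardX -scalerAr -exprM -exprD; congr (_ *: 'X^_).
rewrite mulnBl mul1n -expnD [RHS]addnC addnBA ?expn_gt0 ?q_gt0 //.
by rewrite subnK // leq_pexp2l ?q_gt0 ?leq_addl.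
Qed.

Lemma deriv_linearized_tail m n a : (0 < m)%N -> (linearized q m n a)^`() = 0.
Proof.
move=> m_gt0; rewrite /linearized raddf_sum /= big_nat_cond big1 //.
move=> i /andP[/andP[le_mi _] _].
rewrite derivZ derivXn -mulr_natl -polyC_natr.
by rewrite natr_card ?mul0r ?scaler0 // (leq_trans m_gt0).
Qed.

Lemma deriv_linearized0 n a : (linearized q 0 n a)^`() = (a 0%N)%:P.
Proof.
have -> : linearized q 0 n a = a 0%N *: 'X + linearized q 1 n a.
  by rewrite /linearized big_ltn // expn0 expr1.
by rewrite derivD derivZ derivX deriv_linearized_tail // addr0 alg_polyC.
Qed.

Lemma linearized_over_X_at0 n a : (linearized_over_X q 0 n a).[0] = a 0%N.
Proof.
rewrite /linearized_over_X big_ltn // subnn expr0 hornerD hornerZ hornerC mulr1.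
rewrite horner_sum big_nat_cond big1 ?addr0 // => i /andP[/andP[i_gt0 _] _].
rewrite hornerZ hornerXn expr0n subn_eq0 leqNgt.
by rewrite -{1}(expn0 q) ltn_exp2l ?q_gt1 // i_gt0 mulr0.
Qed.

End Linearized.

(** * Factors of L(X)/X - t over fields of Laurent series *)

Section Transcendence.

Variables (F k : fieldType) (psi : {rmorphism F -> k}).

Definition to_laurent : {rmorphism F -> {fraction fps k}} :=
  @tofrac (fps k) \o (@fps_const k \o psi).

Lemma horner_fps_var (p : {poly k}) i : (map_poly (@fps_const k) p).[fps_var k] i = p`_i.
Proof.
elim/poly_ind: p i => [|p c IHp] i; first by rewrite map_poly0 horner0 coef0.
rewrite rmorphD rmorphM /= map_polyX map_polyC /= hornerMXaddC mulrC.
rewrite fpsDE fps_varM coefD coefMX coefC.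
by case: i => [|i]; rewrite ?IHp.
Qed.

(** Evaluating p at the variable gives the power series with the coefficients
    of p. *)
Lemma transcendental_fps_var : ~ algebraicOver to_laurent (tofrac (fps_var k)).
Proof.
case=> p nz_p; rewrite /root.
have -> : map_poly to_laurent p
    = map_poly (@tofrac (fps k)) (map_poly (@fps_const k) (map_poly psi p)).
  by rewrite -!map_poly_comp.
rewrite horner_map tofrac_eq0 => /eqP pT0; case/eqP: nz_p.
apply/polyP => i; apply: (fmorph_inj psi); rewrite -coef_map -horner_fps_var pT0.
by rewrite coef0 rmorph0.
Qed.

End Transcendence.

Lemma map_linearized_over_X_sub_t (F : fieldType) q m n (a : nat -> F) (L : fieldType)
    (phi : {rmorphism F -> L}) (i : {rmorphism {fraction {poly F}} -> L}) :
    (forall c, i (ratfun_const c) = phi c) ->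
  map_poly i (linearized_over_X_sub_t q m n a)
    = map_poly phi (linearized_over_X q m n a) - (i (ratfun_t F))%:P.
Proof.
move=> iE; rewrite /linearized_over_X_sub_t rmorphB /= map_polyC.
rewrite -map_poly_comp_id0 ?rmorph0 //.
by congr (_ - _); apply: eq_map_poly.
Qed.

Section Local.

Variables (F : finFieldType) (q : nat).
Hypothesis cardF : #|F| = q.
Variables (n m : nat) (a : nat -> F).
Hypotheses (m_gt0 : (0 < m)%N) (lt_mn : (m < n)%N) (nz_am : a m != 0) (nz_an : a n != 0).

Local Notation K := {fraction {poly F}}.
Local Notation F0 := (linearized_over_X q m n a).
Local Notation f := (linearized_over_X_sub_t q m n a).

(** Sending t to 1/u embeds K in F((u)), where u f = u L(X)/X - 1 is constant
    modulo u and has leading coefficient u a_n. *)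
Lemma irreducible_linearized_over_X_sub_t : irreducible_poly f.
Proof.
have [szF0 lcF0] := size_linearized_over_X cardF (ltnW lt_mn) nz_an.
have q_n : (1 < q ^ n)%N.
  by rewrite -(expn0 q) ltn_exp2l ?(q_gt1 cardF) // (leq_trans _ lt_mn).
pose phi := to_laurent (idfun : {rmorphism F -> F}).
pose u : {fraction fps F} := tofrac (fps_var F).
have nz_u : u != 0 by rewrite tofrac_eq0 fps_var_neq0.
have [|i [iC iT]] := @ratfun_lift _ _ phi u^-1.
  by move=> /algebraic_inv; rewrite invrK; apply: transcendental_fps_var.
pose P := fps_var F *: map_poly (@fps_const F) F0 - 1.
have DP : map_poly (@tofrac (fps F)) P = u *: map_poly i f.
  rewrite (map_linearized_over_X_sub_t _ _ _ _ iC) iT rmorphB rmorph1 /= map_polyZ.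
  rewrite scalerBr -map_poly_comp; congr (_ - _).
  by rewrite -mul_polyC -polyCM mulfV.
have szP1 : size (fps_var F *: map_poly (@fps_const F) F0) = (q ^ n)%N.
  by rewrite size_scale ?fps_var_neq0 // size_map_poly.
have irrP : irreducible_poly (map_poly (@tofrac (fps F)) P).
  apply: (eisenstein_infinity (fps_uniformizer F)).
  - rewrite rmorphB rmorph1 /= map_polyZ /= scale0r sub0r size_polyN size_poly1 //.
  - by rewrite /P size_polyDl szP1 // size_polyN size_poly1.
  move=> y; rewrite lead_coefDl ?szP1 ?size_polyN ?size_poly1 //.
  rewrite lead_coefZ lead_coef_map lcF0 expr2 -mulrA; apply/eqP.
  move/(mulfI (fps_var_neq0 F))/(congr1 (fun g : fps F => g 0%N))/eqP.
  by rewrite fps_varM /= (negPf nz_an).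
have [P_gt1 irr] := irrP; split=> [|g g_neq1 dv_gf].
  by rewrite DP size_scale // size_map_poly in P_gt1.
rewrite -(eqp_map i) -(eqp_rtrans (eqp_scale _ nz_u)) -DP irr ?size_map_poly //.
by rewrite DP dvdpZr // dvdp_map.
Qed.

(** In characteristic p, X f = L - t X has derivative - t, so f + X f' = - t is a
    Bezout relation between f and f'. *)
Lemma separable_linearized_over_X_sub_t : separable_poly f.
Proof.
rewrite unlock; apply/Bezout_coprimepP; exists (1, 'X) => /=.
have nz_t : - ratfun_t F != 0 by rewrite oppr_eq0 tofrac_eq0 polyX_eq0.
have -> : 1 * f + 'X * f^`() = (- ratfun_t F)%:P; last by rewrite polyC_eqp1.
transitivity (f * 'X)^`().
  by rewrite derivM derivX mulr1 mul1r addrC mulrC.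
pose const : {rmorphism F -> K} := @tofrac {poly F} \o @polyC F.
have -> : f * 'X = map_poly const (linearized q m n a) - ratfun_t F *: 'X.
  rewrite mulrBl mul_polyC -linearized_over_XE ?(q_gt0 cardF) // rmorphM /=.
  by rewrite map_polyX.
rewrite derivB derivZ derivX deriv_map deriv_linearized_tail // map_poly0 sub0r.
by rewrite alg_polyC polyCN.
Qed.

(** Both factors come from hensel_eisenstein applied to L(X)/X = X^(q^m - 1) N^(q^m):
    A at the root 0, B at a nonzero root b of N. *)
Lemma local_factors : exists (L : fieldType) (i : {rmorphism K -> L}) (A B : {poly L}),
  [/\ irreducible_poly A /\ irreducible_poly B,
      A %| map_poly i f, B %| map_poly i f, size A = (q ^ m)%N & size B = (q ^ m).+1].
Proof.
pose N := linearized_over_X q 0 (n - m) (fun i => a (i + m)%N).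
have szN : (1 < size N)%N.
  have [|-> _] := size_linearized_over_X cardF (n := (n - m)%N) (m := 0)
    (a := fun i => a (i + m)%N) (leq0n _); first by rewrite subnK // ltnW.
  by rewrite -(expn0 q) ltn_exp2l ?(q_gt1 cardF) // subn_gt0.
have [k [b [Nb0 _]]] := root_extension szN.
pose psi : {rmorphism F -> k} := in_alg k.
pose phi := to_laurent psi.
have [|i [iC iT]] := @ratfun_lift _ _ phi (tofrac (fps_var k)).
  exact: transcendental_fps_var.
have q_m0 : (0 < q ^ m - 1)%N.
  by rewrite subn_gt0 -(expn0 q) ltn_exp2l ?(q_gt1 cardF).
have Dfi : map_poly i f = map_poly (@tofrac (fps k))
    (map_poly (@fps_const k) (map_poly psi F0) - (fps_var k)%:P).
  rewrite (map_linearized_over_X_sub_t _ _ _ _ iC) iT rmorphB /= map_polyC.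
  by rewrite -!map_poly_comp.
have DF0 : map_poly psi F0 = 'X^(q ^ m - 1) * map_poly psi N ^+ (q ^ m).
  rewrite (linearized_over_X_frobenius cardF) ?(ltnW lt_mn) //.
  rewrite rmorphM; congr (_ * _).
    exact: map_polyXn.
  exact: rmorphXn.
have N0 : (map_poly psi N).[0] = psi (a m).
  by rewrite -(rmorph0 psi) horner_map linearized_over_X_at0.
have nz_psi_am : psi (a m) != 0 by rewrite fmorph_eq0.
have [||A [szA dvA irrA]] := @hensel_eisenstein k (map_poly psi F0)
    (map_poly psi N ^+ (q ^ m)) 0 _ q_m0.
- by rewrite horner_exp N0 expf_neq0.
- by rewrite subr0.
have [N1 DN] : exists N1, map_poly psi N = N1 * ('X - b%:P) by apply/factor_theorem.
(* The root b of N is simple, because X N has the nonzero constant derivative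
   a_m; the same identity shows that b is nonzero. *)
have N1b : N1.[b] * b = psi (a m).
  have: (map_poly psi N * 'X)^`().[b] = psi (a m).
    rewrite -(map_polyX psi) -rmorphM linearized_over_XE ?(q_gt0 cardF) //=.
    by rewrite deriv_map deriv_linearized0 // map_polyC hornerC.
  rewrite DN -mulrA [_ * 'X]mulrC mulrA derivM derivXsubC mulr1.
  by rewrite hornerD !hornerM hornerXsubC subrr mulr0 add0r hornerX.
have /andP[nz_N1b nz_b] : (N1.[b] != 0) && (b != 0).
  by rewrite -negb_or -mulf_eq0 N1b.
have [|||B [szB dvB irrB]] := @hensel_eisenstein k (map_poly psi F0)
    ('X^(q ^ m - 1) * N1 ^+ (q ^ m)) b (q ^ m).
- by rewrite expn_gt0 (q_gt0 cardF).
- by rewrite hornerM hornerXn horner_exp mulf_neq0 ?expf_neq0.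
- by rewrite DF0 DN exprMn mulrCA mulrA mulrC mulrA [_ * N1 ^+ _]mulrC -mulrA mulrC.
exists {fraction fps k}, i, (map_poly (@tofrac (fps k)) A).
exists (map_poly (@tofrac (fps k)) B).
rewrite Dfi !size_map_tofrac szA szB subn1 prednK ?expn_gt0 ?(q_gt0 cardF) //.
Qed.

End Local.

(** * Degree of the splitting field *)

Section SplittingDegree.

Variables (K L : fieldType) (E : splittingFieldType K) (i : {rmorphism K -> L}).
Variables (f : {poly K}) (A B : {poly L}).
Hypotheses (sep_f : separable_poly f) (splitE : is_splitting_field f E).
Hypotheses (irr_A : irreducible_poly A) (dvA : A %| map_poly i f).
Hypotheses (irr_B : irreducible_poly B) (dvB : B %| map_poly i f).

Lemma galois_splitting_field : galois 1 {:E}.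
Proof.
apply/splitting_galoisField; exists (map_poly (in_alg E) f); split=> //.
  by apply/polyOver1P; exists f.
by rewrite separable_map.
Qed.

(** In an extension O of L generated by an image of E, the degree over L is
    divisible by the degrees of A and B.  Let v be a root of f that becomes a root of
    B: since [L(v) : L] is the degree of B, prime to that of A, the degree of A
    divides [O : L(v)], which divides [E : K(v)], while [K(v) : K] is the degree of
    f. *)
Lemma dvdn_splitting_degree : irreducible_poly f ->
    coprime (size A).-1 (size B).-1 ->
  ((size f).-1 * (size A).-1 %| \dim {:E})%N /\ ((size B).-1 %| \dim {:E})%N.
Proof.
move=> irr_f co_AB; have galE := galois_splitting_field.
have [x genE] : exists x, <<1; x>>%VS = {:E}%VS.
  exists (separable_generator 1 {:E}); apply/esym/eq_adjoin_separable_generator.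
    by case/and3P: galE.
  exact: sub1v.
have /polyOver1P[p Dp] := minPolyOver 1 x.
have p_gt1 : (1 < size (map_poly i p))%N.
  by rewrite size_map_poly -(size_map_poly (in_alg E)) -Dp
    size_minPoly ltnS /adjoin_degree.
have [O [y [py0 genO]]] := root_extension p_gt1.
pose i' : {rmorphism K -> O} := in_alg O \o i.
have [|j [jx jC]] := @extend_to_simple_extension _ _ E i' p x y (esym Dp) genE.
  by rewrite map_poly_comp.
have jP (h : {poly K}) :
    map_poly j (map_poly (in_alg E) h) = map_poly (in_alg O) (map_poly i h).
  by rewrite -!map_poly_comp; apply: eq_map_poly => c /=; rewrite jC.
have [rs Drs _] := splitE.
have rootO C : irreducible_poly C -> C %| map_poly i f ->
    exists2 z : E, root (map_poly (in_alg E) f) z & root (map_poly (in_alg O) C) (j z).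
  move=> irr_C dvC; have dvCO : map_poly (in_alg O) C %| \prod_(r <- rs) ('X - (j r)%:P).
    have -> : \prod_(r <- rs) ('X - (j r)%:P) = map_poly j (\prod_(r <- rs) ('X - r%:P)).
      by rewrite rmorph_prod; apply: eq_bigr => r _;
        rewrite /= rmorphB /= map_polyX map_polyC.
    rewrite -(eqp_dvdr _ (_ : map_poly j (map_poly (in_alg E) f) %= _)).
      by rewrite jP dvdp_map.
    by rewrite eqp_map.
  have [mk Dmk] := dvdp_prod_XsubC dvCO.
  have := eqp_size Dmk; rewrite size_map_poly size_prod_XsubC => szC.
  have [r r_mk] : exists r, r \in mask mk rs.
    move: irr_C.1; rewrite szC; case: (mask mk rs) => [|r s] // _.
    by exists r; rewrite mem_head.
  exists r; first by rewrite (eqp_root Drs) root_prod_XsubC (mem_mask r_mk).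
  rewrite (eqp_root Dmk) -(big_map j predT (fun r => 'X - r%:P)) root_prod_XsubC.
  exact: map_f.
have [u fu0 Au0] := rootO A irr_A dvA.
have [v fv0 Bv0] := rootO B irr_B dvB.
have genM (M : {subfield E}) : <<M; x>>%VS = {:E}%VS.
  by apply/eqP; rewrite eqEsubv subvf -genE adjoinSl ?sub1v.
have genM' (M : {subfield O}) : <<M; j x>>%VS = {:O}%VS.
  by apply/eqP; rewrite jx eqEsubv subvf -genO adjoinSl ?sub1v.
have dim_adjoin (k : fieldType) (N : fieldExtType k) (g : {poly k}) (z : N) :
    irreducible_poly g -> root (map_poly (in_alg N) g) z -> \dim <<1; z>> = (size g).-1.
  by move=> irr_g gz0; rewrite dim_Fadjoin dimv1 muln1 (adjoin_degree_irreducible irr_g).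
have dvA_O : ((size A).-1 %| \dim {:O})%N.
  by rewrite -(dim_adjoin _ _ _ _ irr_A Au0) field_dimS ?subvf.
have dvB_O : ((size B).-1 %| \dim {:O})%N.
  by rewrite -(dim_adjoin _ _ _ _ irr_B Bv0) field_dimS ?subvf.
split; last first.
  apply: dvdn_trans dvB_O _.
  have := @dvdn_degree_base_change _ _ E O j 1%AS 1%AS x _ (genM _) (genM' _).
  rewrite !dimv1 !divn1; apply=> c /vlineP[d ->].
  by rewrite jC /= rpredZ ?rpred1.
have dimE := dim_sup_field (subvf <<1; v>>%AS).
have dimO := dim_sup_field (subvf <<1; j v>>%AS).
rewrite dimE mulnC dvdn_mul //; last by rewrite (dim_adjoin _ _ _ _ irr_f fv0).
apply: (@dvdn_trans (\dim_(<<1; j v>>) {:O})).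
  by move: dvA_O; rewrite {1}dimO (dim_adjoin _ _ _ _ irr_B Bv0) Gauss_dvdl.
apply: (@dvdn_degree_base_change _ _ E O j <<1; v>>%AS <<1; j v>>%AS x).
- move=> _ /Fadjoin1_polyP[h ->]; apply/Fadjoin1_polyP.
  by exists (map_poly i h); rewrite -jP horner_map.
- exact: genM.
- exact: genM'.
Qed.

End SplittingDegree.

Theorem proposition2 (q : nat) (F : finFieldType) (hF : #|F| = q)
    (n m : nat) (a : nat -> F)
    (hn : (0 < n)%N) (hm1 : (1 <= m)%N) (hmn : (m <= n - 1)%N)
    (ham : a m != 0%R) (han : a n != 0%R)
    (E : splittingFieldType {fraction {poly F}})
    (hE : is_splitting_field (linearized_over_X_sub_t q m n a) E) :
  (q ^ m * (q ^ m - 1) * (q ^ n - 1) %| #|'Gal({:E} / 1)%g|)%N.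
Proof.
have lt_mn : (m < n)%N by rewrite -(subnK hn) addn1 ltnS.
have sep_f := separable_linearized_over_X_sub_t hF n a hm1.
have irr_f := irreducible_linearized_over_X_sub_t hF lt_mn han.
have [L [i [A [B [[irr_A irr_B] dvA dvB szA szB]]]]] :=
  local_factors hF hm1 lt_mn ham han.
have cop_pred j : (0 < j)%N -> coprime (q ^ m) (q ^ j - 1).
  move=> j_gt0; rewrite coprimeXl // (coprime_dvdl (dvdn_exp j_gt0 (dvdnn q))) //.
  by rewrite coprime_sym subn1 coprimePn // expn_gt0 (q_gt0 hF).
have szf : size (linearized_over_X_sub_t q m n a) = (q ^ n)%N.
  have [szF0 _] := size_linearized_over_X hF (ltnW lt_mn) han.
  pose const : {rmorphism F -> {fraction {poly F}}} := @tofrac {poly F} \o @polyC F.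
  have szF0' : size (map_poly (@ratfun_const F) (linearized_over_X q m n a)) = (q ^ n)%N.
    by rewrite -szF0; apply: (size_map_poly const).
  rewrite size_polyDl szF0' // size_polyN (leq_ltn_trans (size_polyC_leq1 _)) //.
  by rewrite -(expn0 q) ltn_exp2l ?(q_gt1 hF).
rewrite -(galois_dim (galois_splitting_field sep_f hE)) dimv1 divn1.
have [] := dvdn_splitting_degree sep_f hE irr_A dvA irr_B dvB irr_f.
  by rewrite szA szB /= coprime_sym -subn1 cop_pred.
rewrite szf szA szB /= -!subn1 => dv1 dv2.
rewrite -mulnA Gauss_dvd ?dv2; first by rewrite mulnC.
by rewrite coprimeMr !cop_pred.
Qed.
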